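(* Let $A\in SL(\mathbb{Z},2)$ and suppose that all eigenvalues of $A$ have modulus $1$. Then the flow $\mathcal{X}=(\mathbb{T}^2,\ T\mathbf{x}=A\mathbf{x})$ is MMA and MMLS.
   Context: $\mathbb{T}^2=\mathbb{R}^2/\mathbb{Z}^2$ with the metric induced from the Euclidean metric: $\|\mathbf{x}-\mathbf{y}\|_{\mathbb{T}^2}=\inf_{\mathbf{n}\in\mathbb{Z}^2}\|\mathbf{x}-\mathbf{y}-\mathbf{n}\|_{\mathbb{R}^2}$. Here $SL(\mathbb{Z},2)$ denotes the set of $2\times2$ integer matrices $A$ with $\det A=\pm1$; each acts on $\mathbb{T}^2$ by $\mathbf{x}\mapsto A\mathbf{x}$. A flow $(X,T)$ is a compact metric space $(X,d)$ with a continuous map $T:X\to X$. A minimal subset $K\subseteq X$ is a non-empty closed subset with $T(K)\subseteq K$ such that $T:K\to K$ is minimal (every forward orbit in $K$ is dense in $K$). The upper density of $E\subseteq\mathbb{N}$ is $\overline{D}(E)=\limsup_{n\to\infty}\frac{\#(E\cap[1,n])}{n}$. A flow is mean-L-stable (MLS) if for every $\epsilon>0$ there is $\delta>0$ such that $d(x,y)<\delta$ implies $d(T^nx,T^ny)<\epsilon$ for all $n=0,1,2,\dots$ except for a set of natural numbers of upper density less than $\epsilon$. A flow $(X,T)$ is minimally mean-L-stable (MMLS) if for every minimal subset $K\subseteq X$ the sub-flow $(K,T)$ is MLS. Given a minimal subset $K$, a point $x\in X$ is mean attracted to $K$ if for every $\epsilon>0$ there is $z=z_{\epsilon,x}\in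 K$ with $\limsup_{N\to\infty}\frac1N\sum_{n=1}^N d(T^nx,T^nz)<\epsilon$; $\mathrm{Basin}(K)$ is the set of all points mean attracted to $K$. A flow is minimally mean attractable (MMA) if $X=\bigcup_K \mathrm{Basin}(K)$, where $K$ ranges over all minimal subsets of $X$. *)

(* Defs.v *)
From HB Require Import structures.
From mathcomp Require Import all_boot all_order all_algebra.
From mathcomp Require Import ring complex.
From mathcomp Require Import all_classical all_reals all_analysis.

Set Implicit Arguments.
Unset Strict Implicit.
Unset Printing Implicit Defensive.

Import Order.TTheory GRing.Theory Num.Theory.
Import numFieldNormedType.Exports.

Local Open Scope classical_set_scope.
Local Open Scope ring_scope.
Local Open Scope quotient_scope.

Structure flow (R : realType) := Flow {
  flow_space :> metricType R;
  flow_map : flow_space -> flow_space;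
  flow_compact : compact [set: flow_space];
  flow_continuous : continuous flow_map
}.
Arguments Flow {R} flow_space flow_map flow_compact flow_continuous.
Arguments flow_map {R} f _.

Section flows.
Context {R : realType}.

Definition upper_density (E : set nat) : \bar R :=
  limn_esup (fun n => ((count (fun k => k \in E) (index_iota 1 n.+1))%:R
                       / n%:R)%:E).

Variable X : flow R.
Implicit Types K : set X.

Definition minimal_subset K : Prop :=
  [/\ K !=set0, closed K, flow_map X @` K `<=` K
    & forall x, K x ->
        K `<=` closure [set iter n (flow_map X) x | n in [set: nat]]].

(* Mean-L-stability of the sub-flow on K, whose metric is the restriction of
   that of X. E is the set of exceptional times. *)
Definition mean_L_stable_on K : Prop :=
  forall eps : R, 0 < eps -> exists2 delta : R, 0 < delta &
    forall x y, K x -> K y -> mdist x y < delta ->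
      exists2 E : set nat, (upper_density E < eps%:E)%E &
        forall n, ~ E n ->
          mdist (iter n (flow_map X) x) (iter n (flow_map X) y) < eps.

Definition mean_L_stable : Prop := mean_L_stable_on [set: X].

Definition minimally_mean_L_stable : Prop :=
  forall K, minimal_subset K -> mean_L_stable_on K.

Definition mean_attracted K (x : X) : Prop :=
  forall eps : R, 0 < eps -> exists2 z, K z &
    (limn_esup (fun N =>
       (N%:R^-1 * \sum_(1 <= n < N.+1)
          mdist (iter n (flow_map X) x) (iter n (flow_map X) z))%:E)
     < eps%:E)%E.

Definition basin K : set X := [set x | mean_attracted K x].

Definition minimally_mean_attractable : Prop :=
  [set: X] = \bigcup_(K in [set K | minimal_subset K]) basin K.

End flows.
Arguments mean_L_stable {R} X.
Arguments minimally_mean_L_stable {R} X.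
Arguments minimally_mean_attractable {R} X.

(* The library norm on column vectors is the sup norm. *)
Definition enorm (R : realType) (v : 'cV[R]_2) : R :=
  Num.sqrt (\sum_i v i 0 ^+ 2).

Definition intv (R : realType) (n : 'cV[int]_2) : 'cV[R]_2 := map_mx intr n.
Arguments intv R n : clear implicits.

Section enorm_theory.
Context {R : realType}.
Implicit Types v w : 'cV[R]_2.

Lemma enormE v : enorm v = Normc.normc (Complex (v 0 0) (v 1 0)).
Proof.
rewrite /enorm /Normc.normc big_ord_recl big_ord1; congr (Num.sqrt (_ + _ ^+ 2)).
by congr (v _ 0); exact/val_inj.
Qed.

Lemma enorm_ge0 v : 0 <= enorm v. Proof. exact: sqrtr_ge0. Qed.

Lemma enorm0 : enorm (0 : 'cV[R]_2) = 0.
Proof. by rewrite enormE !mxE Normc.normc0. Qed.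

Lemma enormD v w : enorm (v + w) <= enorm v + enorm w.
Proof.
rewrite !enormE (le_trans _ (le_normcD _ _))//.
by rewrite !mxE.
Qed.

Lemma enormN v : enorm (- v) = enorm v.
Proof. by rewrite /enorm; under eq_bigr do rewrite mxE sqrrN. Qed.

Lemma enorm_coord v i : `|v i 0| <= enorm v.
Proof.
rewrite -sqrtr_sqr ler_wsqrtr// (bigD1 i)//= lerDl sumr_ge0// => j _.
exact: sqr_ge0.
Qed.

Lemma enorm_le v : enorm v <= \sum_i `|v i 0|.
Proof.
rewrite -(ger0_norm (sumr_ge0 _ _)); last by move=> i _; exact: normr_ge0.
rewrite -sqrtr_sqr ler_wsqrtr// !big_ord_recl !big_ord0 !addr0.
rewrite sqrrD -!normrX !(ger0_norm (sqr_ge0 _)).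
  rewrite addrAC lerDl.
by rewrite mulrn_wge0// mulr_ge0.
Qed.

Lemma enorm_eq0 v : enorm v = 0 -> v = 0.
Proof.
move=> v0; apply/matrixP => i j; rewrite mxE ord1; apply/eqP.
by rewrite -normr_le0 -v0 enorm_coord.
Qed.

Lemma enorm_mulmx (A : 'M[int]_2) :
  exists2 C : R, 0 < C &
    forall v, enorm (map_mx intr A *m v) <= C * enorm v.
Proof.
exists (1 + \sum_i \sum_j `|(A i j)%:~R|).
  by rewrite ltr_pwDl// sumr_ge0// => i _; rewrite sumr_ge0.
move=> v; apply: (le_trans (enorm_le _)).
rewrite mulrDl mul1r mulr_suml -[leLHS]add0r lerD ?enorm_ge0//.
apply: ler_sum => i _; rewrite mxE (le_trans (ler_norm_sum _ _ _))//.
rewrite mulr_suml ler_sum// => j _; rewrite mxE normrM.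
by rewrite ler_wpM2l// enorm_coord.
Qed.

End enorm_theory.

Definition Z2 (R : realType) : {pred 'cV[R]_2} :=
  fun v => v \is a mxOver Num.int.

Fact Z2_zmod_closed (R : realType) : zmod_closed (@Z2 R).
Proof.
split=> [|v w /mxOverP vZ /mxOverP wZ]; apply/mxOverP => i j.
  by rewrite mxE rpred0.
by rewrite !mxE rpredB.
Qed.

HB.instance Definition _ (R : realType) :=
  GRing.isZmodClosed.Build 'cV[R]_2 (@Z2 R) (@Z2_zmod_closed R).

Lemma Z2P (R : realType) (v : 'cV[R]_2) :
  reflect (exists n, v = intv R n) (v \in @Z2 R).
Proof.
apply: (iffP mxOverP) => [vZ|[n ->] i j]; last by rewrite mxE intr_int.
exists (\col_i Num.floor (v i 0)); apply/matrixP => i j.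
by rewrite !mxE ord1 floorK.
Qed.

(* The quotient of the additive group R^2 by the subgroup Z^2. *)
Definition torus (R : realType) : Type := Quotient.quot (@Z2 R).

HB.instance Definition _ (R : realType) := ZmodQuotient.on (torus R).
HB.instance Definition _ (R : realType) := Choice.on (torus R).

Section torus_metric.
Context {R : realType}.
Implicit Types (v w : 'cV[R]_2) (x y z : torus R).

(* Independent of the chosen representatives: see torus_distE below. *)
Definition torus_dist x y : R :=
  inf [set enorm (repr x - repr y - intv R n) | n in [set: 'cV[int]_2]].

Lemma pi_eqP v w :
  reflect (exists n, v = w + intv R n) (\pi_(torus R) v == \pi_(torus R) w).
Proof.
rewrite -Quotient.idealrBE; apply: (iffP (Z2P _)) => -[n vw]; exists n.
  by rewrite -vw addrC subrK.
by rewrite vw addrC addrA addNr add0r.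
Qed.

Lemma repr_pi v : exists n, repr (\pi_(torus R) v) = v + intv R n.
Proof. by apply/pi_eqP; rewrite reprK. Qed.

Lemma intvD n m : intv R (n + m) = intv R n + intv R m.
Proof. by apply/matrixP => i j; rewrite !mxE intrD. Qed.

Lemma intvN n : intv R (- n) = - intv R n.
Proof. by apply/matrixP => i j; rewrite !mxE mulrNz. Qed.

Lemma torus_distE v w :
  torus_dist (\pi v) (\pi w) =
  inf [set enorm (v - w - intv R n) | n in [set: 'cV[int]_2]].
Proof.
rewrite /torus_dist; have [a ->] := repr_pi v; have [b ->] := repr_pi w.
congr inf; apply/seteqP; split => _ /= [n _ <-].
  exists (n - a + b) => //; congr enorm.
  by apply/matrixP => i j; rewrite !mxE !intrD mulrNz; ring.
exists (n + a - b) => //; congr enorm.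
by apply/matrixP => i j; rewrite !mxE !intrD mulrNz; ring.
Qed.

Lemma torus_dist_le v w n :
  torus_dist (\pi v) (\pi w) <= enorm (v - w - intv R n).
Proof.
rewrite torus_distE; apply: ge_inf; last by exists n.
by exists 0 => _ [m _ <-]; exact: enorm_ge0.
Qed.

Lemma torus_dist_lt v w e : torus_dist (\pi v) (\pi w) < e ->
  exists n, enorm (v - w - intv R n) < e.
Proof.
rewrite torus_distE -subr_gt0 => e0; set S := (X in inf X) in e0 *.
have Sinf : has_inf S.
  split; first by exists (enorm (v - w - intv R 0)), 0.
  by exists 0 => _ [m _ <-]; exact: enorm_ge0.
have [_ [n _ <-]] := inf_adherent e0 Sinf.
by rewrite [X in _ < X]addrC subrK; exists n.
Qed.

Lemma torus_dist_ge v w c : (forall n, c <= enorm (v - w - intv R n)) ->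
  c <= torus_dist (\pi v) (\pi w).
Proof.
move=> cle; rewrite torus_distE; apply: lb_le_inf.
  by exists (enorm (v - w - intv R 0)), 0.
by move=> _ [n _ <-]; exact: cle.
Qed.

Lemma torus_dist_ge0 x y : 0 <= torus_dist x y.
Proof.
rewrite -[x]reprK -[y]reprK; apply: torus_dist_ge => n.
exact: enorm_ge0.
Qed.

Fact torus_distxx x : torus_dist x x = 0.
Proof.
apply/eqP; rewrite eq_le torus_dist_ge0 andbT -[x]reprK.
rewrite (le_trans (torus_dist_le _ _ 0))//.
rewrite subrr sub0r (_ : intv R 0 = 0) ?oppr0 ?enorm0//.
by apply/matrixP => i j; rewrite !mxE.
Qed.

Fact torus_dist_eq0 x y : torus_dist x y = 0 -> x = y.
Proof.
rewrite -[x]reprK -[y]reprK; set v := repr x; set w := repr y => d0.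
have [n0 n0P] : exists n, enorm (v - w - intv R n) < 2^-1.
  by apply: torus_dist_lt; rewrite d0 invr_gt0.
apply/eqP/pi_eqP; exists n0; apply/eqP; rewrite addrC -subr_eq -subr_eq0.
apply/eqP/enorm_eq0/eqP; rewrite eq_le enorm_ge0 andbT leNgt; apply/negP => c0.
set c := enorm _ in n0P c0.
have [n nP] : exists n, enorm (v - w - intv R n) < c.
  by apply: torus_dist_lt; rewrite d0.
suff nn0 : n = n0 by rewrite nn0 ltxx in nP.
apply/eqP; rewrite -subr_eq0; apply/eqP/matrixP => i j.
rewrite [RHS]mxE ord1; apply/eqP; rewrite -[_ == _]negbK; apply/negP => ne.
have : 1 <= `|((n - n0) i 0)%:~R : R|.
  by rewrite norm_intr_ge1 ?intr_int// intr_eq0.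
apply/negP; rewrite -ltNge.
have -> : ((n - n0) i 0)%:~R =
    ((v - w - intv R n0) - (v - w - intv R n)) i 0 :> R.
  by rewrite !mxE rmorphB/=; ring.
rewrite (le_lt_trans (enorm_coord _ _))// (le_lt_trans (enormD _ _))//.
by rewrite enormN [ltRHS](splitr 1) mul1r ltrD// (lt_trans nP).
Qed.

Fact torus_dist_sym x y : torus_dist x y = torus_dist y x.
Proof.
suff le a b : torus_dist a b <= torus_dist b a.
  by apply/eqP; rewrite eq_le !le.
rewrite -[a]reprK -[b]reprK; apply: torus_dist_ge => n.
rewrite (le_trans (torus_dist_le _ _ (- n)))// -enormN intvN.
by rewrite opprK opprD opprB.
Qed.

Fact torus_dist_triangle y x z :
  torus_dist x z <= torus_dist x y + torus_dist y z.
Proof.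
rewrite -[x]reprK -[y]reprK -[z]reprK.
rewrite -lerBlDr; apply: torus_dist_ge => n.
rewrite lerBlDr addrC -lerBlDr; apply: torus_dist_ge => m.
rewrite lerBlDr (le_trans (torus_dist_le _ _ (n + m)))//.
rewrite (le_trans _ (enormD _ _))// intvD le_eqVlt; apply/orP; left.
apply/eqP; congr enorm; apply/matrixP => i j; rewrite !mxE; ring.
Qed.

HB.instance Definition _ := isMetric.Build R (torus R)
  torus_distxx torus_dist_eq0 torus_dist_sym torus_dist_triangle.

Lemma torus_mdistE x y : mdist x y = torus_dist x y.
Proof. by []. Qed.

Lemma torus_compact : compact [set: torus R].
Proof.
pose f (p : R * R) : torus R :=
    \pi_(torus R) (\col_i if i == 0 then p.1 else p.2).
have fc : continuous f.
  move=> p; apply/cvg_ballP => e e0.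
  have e20 : 0 < e / 2 by rewrite divr_gt0.
  exists (ball p.1 (e / 2), ball p.2 (e / 2)) => /=.
    by split; exact: nbhsx_ballx.
  move=> [a b] /= [pa pb]; rewrite ballEmdist/= torus_mdistE.
  rewrite (le_lt_trans (torus_dist_le _ _ 0))//.
  rewrite (le_lt_trans (enorm_le _))// big_ord_recl big_ord1 !mxE/= !subr0.
  by rewrite [ltRHS]splitr ltrD.
have -> : [set: torus R] = f @` (`[0, 1] `*` `[0, 1]).
  apply/seteqP; split => // x _; rewrite -[x]reprK; set v := repr x.
  pose g (i : 'I_2) := v i 0 - (Num.floor (v i 0))%:~R.
  have g01 i : g i \in `[0, 1].
    rewrite /g in_itv/= subr_ge0 floor_le/=.
    by rewrite lerBlDl -(intrD _ _ 1) ltW// floorD1_gt.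
  exists (g 0, g 1); first by split; apply: g01.
  apply/eqP/pi_eqP; exists (\col_i - Num.floor (v i 0)).
  apply/matrixP => i j; rewrite !mxE ord1 mulrNz.
  by case: i => -[|[|]]//= ?; rewrite /g; congr (v _ _ - (Num.floor (v _ _))%:~R);
    exact: val_inj.
apply: continuous_compact; first exact: continuous_subspaceT.
by apply: compact_setX; exact: segment_compact.
Qed.

End torus_metric.

Section torus_flow.
Variables (R : realType) (A : 'M[int]_2).

Definition torus_map (x : torus R) : torus R :=
  \pi_(torus R) (map_mx intr A *m repr x).

Lemma torus_mapE (v : 'cV[R]_2) :
  torus_map (\pi v) = \pi_(torus R) (map_mx intr A *m v).
Proof.
rewrite /torus_map; have [n ->] := repr_pi v; apply/eqP/pi_eqP; exists (A *m n).
by rewrite /intv map_mxM/= -mulmxDr.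
Qed.

Lemma torus_map_continuous : continuous torus_map.
Proof.
have [C C0 CP] := @enorm_mulmx R A.
move=> x; apply/(@cvg_ballP R (torus R) (torus R) (nbhs x)) => e e0.
near=> y; rewrite ballEmdist/= torus_mdistE.
have : ball x (e / C) y.
  by near: y; apply: nbhsx_ballx; rewrite divr_gt0.
rewrite ballEmdist/= torus_mdistE -[x]reprK -[y]reprK => /torus_dist_lt[n xy].
rewrite !torus_mapE (le_lt_trans (torus_dist_le _ _ (A *m n)))//.
rewrite /intv map_mxM/= -!mulmxBr (le_lt_trans (CP _))//.
by rewrite mulrC -ltr_pdivlMr.
Unshelve. all: by end_near. Qed.

Definition torus_flow : flow R :=
  Flow (torus R) torus_map torus_compact torus_map_continuous.

End torus_flow.

(* Main.v *)
Require Import Defs.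
From mathcomp Require Import all_boot all_order all_algebra.
From mathcomp Require Import complex.
From mathcomp Require Import ring zify.
From mathcomp Require Import all_classical all_reals all_analysis.

Import Order.TTheory GRing.Theory Num.Theory.
Import numFieldNormedType.Exports.
Local Open Scope ring_scope.

(** The eigenvalues of [A] have modulus 1, so its trace is at most 2 in absolute
value, and it is 0 when the determinant is -1. The finitely many possible
characteristic polynomials are then products of cyclotomic ones, so that for
some [k > 0] the integer matrix [N = A ^+ k - 1] satisfies [N ^+ 2 = 0]
(lemmas [trace_bound] and [quasi_unipotent]).

Hence [A ^+ (k * q) = 1 + N *+ q]: on the torus, the [k * q]-th iterate sends [x]
to [x + q (N x)]. On a fibre of [N] this is a translation, hence an isometry.
Along an orbit, [N] takes at most [k] values, and so it does on the orbit
closure; points of an orbit closure that are close enough therefore lie in the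
same fibre of [N]. Up to the Lipschitz constants of the powers [A ^+ i] with
[i <= k], all iterates then preserve small distances in the orbit closure, in both
directions ([torus_orbit_bi_equicontinuous]).

The rest holds in any flow ([bi_equicontinuous_orbits]). If the iterates are
equicontinuous in both directions on the closure of the orbit of [x], then
compactness makes [x] recurrent, and the orbit closure is minimal. So every point
lies in a minimal set, hence is mean attracted to it, being its own companion
[z]. Moreover every minimal set is contained in the orbit closure of any of its
points, so it is mean-L-stable, without any exceptional times. *)

(** * Flows with bi-equicontinuous orbit closures *)

Section equicontinuity.
Local Open Scope classical_set_scope.
Context {R : realType}.

Lemma closure_mdistP {M : metricType R} (S : set M) (x : M) :
  closure S x <-> forall eps : R, 0 < eps -> exists2 y, S y & mdist x y < eps.
Proof.
split=> [Sx eps eps0|Sx U /nbhs_ballP[eps /= eps0 sub]].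
  have [y [Sy xy]] := Sx _ (nbhsx_ballx x eps eps0).
  by exists y => //; move: xy; rewrite ballEmdist.
have [y Sy xy] := Sx _ eps0.
by exists y; split=> //; apply: sub; rewrite ballEmdist.
Qed.

Lemma finite_image_gap {M : metricType R} {I : finType} (f : I -> M) :
  exists2 gap : R, 0 < gap & forall i j, mdist (f i) (f j) < gap -> f i = f j.
Proof.
exists (\big[Order.min/1]_(p : I * I | f p.1 != f p.2) mdist (f p.1) (f p.2)).
  by apply: lt_bigmin => // p; rewrite mdist_gt0.
move=> i j; apply: contraTeq => fij; rewrite -leNgt.
exact: (@bigmin_le_cond _ _ _ _ (i, j)).
Qed.

Context {X : flow R}.
Local Notation T := (flow_map X).

Definition orbit_closure (x : X) : set X :=
  closure [set iter n T x | n in [set: nat]].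

Lemma mem_orbit_closure x n : orbit_closure x (iter n T x).
Proof. by apply: subset_closure; exists n. Qed.

Lemma orbit_closure_iter {x y} n :
  orbit_closure x y -> orbit_closure x (iter n T y).
Proof.
move=> xy; elim: n => //= n; move: (iter n T y) => {xy}y xy U TyU.
have [_ [[m _ <-] Uy]] := xy _ (@flow_continuous _ X y _ TyU).
by exists (T (iter m T x)); split => //; exists m.+1.
Qed.

Lemma orbit_closure_sub {x y} :
  orbit_closure x y -> orbit_closure y `<=` orbit_closure x.
Proof.
move=> xy; rewrite [X in _ `<=` X](closure_id _).1; last exact: closed_closure.
by apply: closureS => _ [n _ <-]; exact: orbit_closure_iter.
Qed.

(** Uniform equicontinuity on [K] of the iterates of [T] together with their
inverses. *)
Definition bi_equicontinuous (K : set X) : Prop :=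
  forall eps : R, 0 < eps -> exists2 delta : R, 0 < delta &
    forall y z, K y -> K z -> forall n,
      (mdist y z < delta -> mdist (iter n T y) (iter n T z) < eps) /\
      (mdist (iter n T y) (iter n T z) < delta -> mdist y z < eps).

(** By compactness the orbit comes close to itself: its points at two times [i]
and [j] far apart are close to a common cluster point. Applying the inverse of
the [i]-th iterate brings the point at time [j - i] back to [x]. *)
Lemma recurrence x : bi_equicontinuous (orbit_closure x) ->
  forall (eps : R) n, 0 < eps ->
    exists2 m, (n <= m)%N & mdist (iter m T x) x < eps.
Proof.
move=> equi eps n eps0; have [delta delta0 deltaP] := equi _ eps0.
have [z [_ zP]] :
    [set: X] `&` cluster ((fun i => iter i T x) @ \oo) !=set0.
  by apply: flow_compact; exact: filterT.
have near_z k : exists2 i, (k <= i)%N & mdist z (iter i T x) < delta / 2.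
  have delta20 : 0 < delta / 2 by rewrite divr_gt0.
  have [] := zP [set iter i T x | i in [set i | (k <= i)%N]] _ _
    (nbhsx_ballx z _ delta20).
    by exists k => // i /= ki; exists i.
  by move=> _ [[i ki <-]]; rewrite ballEmdist; exists i.
have [i _ iz] := near_z 0; have [j ij jz] := near_z (i + n)%N.
exists (j - i)%N; first by rewrite leq_subRL ?(leq_trans _ ij) ?leq_addr.
have [_ ] := deltaP _ _ (mem_orbit_closure x (j - i)) (mem_orbit_closure x 0) i.
apply; rewrite -iterD subnKC ?(leq_trans _ ij) ?leq_addr//.
rewrite (le_lt_trans (metric_triangle _ z _))// [ltRHS]splitr ltrD//.
by rewrite metric_sym.
Qed.

(** Let [y] be in the orbit closure of [x]. It suffices that the orbit of [y]
returns near [x]: [y] is close to some [iter n T x], so by equicontinuity its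
orbit follows that of [x], which returns near [x] after time [n]. *)
Lemma orbit_closure_minimal x :
  bi_equicontinuous (orbit_closure x) -> minimal_subset (orbit_closure x).
Proof.
move=> equi; split.
- by exists x; exact: (mem_orbit_closure x 0).
- exact: closed_closure.
- by move=> _ [y xy <-]; exact: (orbit_closure_iter 1).
move=> y xy; apply: orbit_closure_sub; apply/closure_mdistP => eps eps0.
have eps20 : 0 < eps / 2 by rewrite divr_gt0.
have [delta delta0 deltaP] := equi _ eps20.
have [_ [n _ <-] yn] := (closure_mdistP _ _).1 xy _ delta0.
have [m nm mx] := recurrence _ equi _ n eps20.
exists (iter (m - n) T y); first by exists (m - n)%N.
have [/(_ yn)] := deltaP _ _ xy (mem_orbit_closure x n) (m - n)%N.
rewrite -iterD subnK// => ym _.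
rewrite (le_lt_trans (metric_triangle _ (iter m T x) _))// [ltRHS]splitr ltrD//.
  by rewrite metric_sym.
by rewrite metric_sym.
Qed.

Lemma limn_esup0 : limn_esup (fun=> 0 : \bar R) = 0%E.
Proof. by have [_ ->] := cvg_limn_einf_sup (@cvg_cst _ (0 : \bar R)%E _ \oo _). Qed.

Lemma upper_density0 : upper_density set0 = 0%E :> \bar R.
Proof.
rewrite -limn_esup0 /upper_density; congr limn_esup; apply/funext => n.
rewrite (eq_count (a2 := pred0)) ?count_pred0 ?mul0r// => k.
by rewrite in_set0.
Qed.

Lemma bi_equicontinuous_mls (K K' : set X) :
  K `<=` K' -> bi_equicontinuous K' -> mean_L_stable_on K.
Proof.
move=> KK' equi eps eps0; have [delta delta0 deltaP] := equi _ eps0.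
exists delta => // x y Kx Ky xy; exists set0; first by rewrite upper_density0.
by move=> n _; apply: (deltaP _ _ (KK' _ Kx) (KK' _ Ky) n).1.
Qed.

(** Every point [x] is mean attracted, with [z = x], to its own orbit closure,
which is minimal; every minimal set lies in the orbit closure of any of its
points. *)
Lemma bi_equicontinuous_orbits :
  (forall x, bi_equicontinuous (orbit_closure x)) ->
  minimally_mean_attractable X /\ minimally_mean_L_stable X.
Proof.
move=> equi; split.
  apply/seteqP; split => // x _.
  exists (orbit_closure x); first exact: orbit_closure_minimal.
  move=> eps eps0; exists x; first exact: (mem_orbit_closure x 0).
  under eq_fun do under eq_bigr do rewrite mdistxx.
  under eq_fun do rewrite big1_eq mulr0.
  by rewrite limn_esup0.
move=> K [[x Kx] _ _ Kmin].
exact: bi_equicontinuous_mls (Kmin _ Kx) (equi x).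
Qed.

End equicontinuity.

(** * Integer matrices with eigenvalues of modulus 1 *)

Lemma char_poly2 (S : comNzRingType) (M : 'M[S]_2) :
  char_poly M = 'X^2 - (\tr M) *: 'X + (\det M)%:P.
Proof.
apply/polyP => -[|[|[|i]]]; rewrite !(coefD, coefN, coefZ, coefC, coefX, coefXn)/=.
- by rewrite char_poly_det expr2 mulrNN !mul1r mulr0 oppr0 !add0r.
- by rewrite (@char_poly_trace _ 2)// mulr1 add0r addr0.
- have /monicP := char_poly_monic M.
  by rewrite /lead_coef size_char_poly => ->; rewrite mulr0 subr0 addr0.
- by rewrite nth_default ?size_char_poly// mulr0 subr0 addr0.
Qed.

(** With an eigenvalue [z], the other root [t - z] of the characteristic
polynomial is an eigenvalue too, which bounds the trace [t]. If the determinant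
is -1, that other root is [- z^*], so the real number [t] is [z - z^*], whose
conjugate is its opposite. *)
Lemma trace_bound (C : numClosedFieldType) (A : 'M[int]_2) :
  (forall z : C, eigenvalue (map_mx intr A) z -> `|z| = 1) ->
  `|\tr A| <= 2 /\ (\det A = -1 -> \tr A = 0).
Proof.
move=> eigA; set t : C := (\tr A)%:~R; set d : C := (\det A)%:~R.
have eigE z : eigenvalue (map_mx intr A) z = (z ^+ 2 - t * z + d == 0).
  by rewrite eigenvalue_root_char char_poly2 /root !hornerE trace_map_mx det_map_mx.
have [z ez] : exists z : C, eigenvalue (map_mx intr A) z.
  have /closed_rootP[z rz] : size (char_poly (map_mx intr A) : {poly C}) != 1.
    by rewrite size_char_poly.
  by exists z; rewrite eigenvalue_root_char.
have ew : eigenvalue (map_mx intr A) (t - z).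
  move: ez; rewrite !eigE => /eqP <-; apply/eqP; ring.
have z1 := eigA _ ez; have w1 := eigA _ ew.
split=> [|detN].
  rewrite -(ler_int C) intr_norm -[_%:~R](subrK z) -/t.
  by rewrite (le_trans (ler_normD _ _))// z1 w1.
have zw : z * (z - t) = 1.
  by move: ez; rewrite eigE /d detN => /eqP ez; rewrite -[RHS]addr0 -ez; ring.
have wz : z - t = z^*.
  apply: (@mulfI _ z); first by rewrite -normr_eq0 z1 oner_eq0.
  by rewrite zw -normCK z1 expr1n.
have tR : t^* = t by rewrite /t rmorph_int.
have /eqP : t + t = 0.
  by rewrite -[X in X + _]tR -[t in t^*](subKr z) wz rmorphB/= conjCK -wz; ring.
by rewrite -mulr2n mulrn_eq0/= intr_eq0 => /eqP.
Qed.

Lemma sqr_mx2 (A : 'M[int]_2) : A ^+ 2 = (\tr A) *: A - (\det A)%:M.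
Proof.
have := Cayley_Hamilton A; rewrite char_poly2.
rewrite rmorphD rmorphB/= linearZ/= rmorphXn/= horner_mx_X horner_mx_C.
by move/eqP; rewrite -addrA addr_eq0 opprD opprK => /eqP.
Qed.

(** For determinant -1 the characteristic polynomial is [X^2 - 1], and [k = 2]. For
determinant 1 it is [(X - 1)^2], [X^2 - X + 1], [X^2 + 1], [X^2 + X + 1] or
[(X + 1)^2]; each divides [(X^k - 1)^2], where [k] is the common order 1, 6, 4, 3
or 2 of its roots. *)
Lemma quasi_unipotent (A : 'M[int]_2) :
  \det A = 1 \/ \det A = -1 -> `|\tr A| <= 2 -> (\det A = -1 -> \tr A = 0) ->
  exists2 k, (0 < k)%N & (A ^+ k - 1) ^+ 2 = 0.
Proof.
move=> detA; rewrite ler_norml => /andP[t1 t2] trN.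
have A2 : A ^+ 2 = \tr A *: A - (\det A)%:M := sqr_mx2 A.
case: detA => detA; last first.
  exists 2%N => //; rewrite A2 detA (trN detA) scale0r sub0r.
  by rewrite [X in - X]raddfN opprK subrr expr0n.
have : \tr A = 2 \/ \tr A = 1 \/ \tr A = 0 \/ \tr A = -1 \/ \tr A = -2 by lia.
rewrite detA -[1%:M]/(1 : 'M[int]_2) in A2.
case=> [|[|[|[|]]]] tA; rewrite tA in A2.
- by exists 1%N; rewrite // expr1 sqrrB1 A2 scaler_nat addrAC subrK subrr.
- exists 6%N => //; rewrite scale1r in A2.
  have A3 : A ^+ 3 = -1.
    by rewrite exprS A2 mulrBr mulr1 -expr2 A2 addrAC subrr sub0r.
  by rewrite (exprM A 3 2) A3 sqrrN expr1n subrr expr0n.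
- exists 4%N => //.
  by rewrite (exprM A 2 2) A2 scale0r sub0r sqrrN expr1n subrr expr0n.
- exists 3%N => //; rewrite scaleN1r in A2.
  have -> : A ^+ 3 = 1.
    by rewrite exprS A2 mulrBr mulr1 mulrN -expr2 A2 opprB opprK addrK.
  by rewrite subrr expr0n.
- exists 2%N => //; rewrite scaleNr scaler_nat in A2.
  have -> : A ^+ 2 - 1 = - ((A + 1) *+ 2).
    by rewrite A2 -addrA -!opprD mulrnDl.
  by rewrite sqrrN exprMn_n sqrrD1 A2 addrAC subrK addNr mul0rn.
Qed.

Lemma sqr0_exprD1 (S : pzRingType) (N : S) q :
  N ^+ 2 = 0 -> (N + 1) ^+ q = 1 + N *+ q.
Proof.
move=> N2; elim: q => [|q IHq]; first by rewrite expr0 mulr0n addr0.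
rewrite exprS IHq mulrDl mul1r mulrDr mulr1 mulrnAr -expr2 N2 mul0rn addr0.
by rewrite addrCA -mulrS.
Qed.

(** * Quasi-unipotent automorphisms of the torus *)

Section torus_endomorphisms.
Local Open Scope quotient_scope.
Context {R : realType}.
Implicit Types (M : 'M[int]_2) (x y : torus R).
Local Notation "M .* x" := (torus_map (R := R) M x) (at level 40).

Lemma torus_mapM M M' x : (M * M') .* x = M .* (M' .* x).
Proof.
rewrite -[x]reprK; move: (repr x) => v.
by rewrite (torus_mapE M' v) !torus_mapE map_mxM mulmxA.
Qed.

Lemma torus_map1 x : 1 .* x = x.
Proof.
by rewrite -[x]reprK; move: (repr x) => v; rewrite torus_mapE map_mx1 mul1mx.
Qed.

Lemma torus_mapD M M' x : (M + M') .* x = M .* x + M' .* x.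
Proof.
rewrite -[x]reprK; move: (repr x) => v.
by rewrite !torus_mapE map_mxD mulmxDl raddfD.
Qed.

Lemma torus_mapMn M x q : (M *+ q) .* x = (M .* x) *+ q.
Proof.
elim: q => [|q IHq]; last by rewrite !mulrS torus_mapD IHq.
by apply: (addIr (0 .* x)); rewrite !mulr0n -torus_mapD !add0r.
Qed.

Lemma iter_torus_map M n x : iter n (flow_map (torus_flow R M)) x = (M ^+ n) .* x.
Proof.
by elim: n => [|n IHn] /=; rewrite ?torus_map1// IHn exprS torus_mapM.
Qed.

Lemma mdist_torusDr x y c : mdist (x + c) (y + c) = mdist x y.
Proof.
rewrite -[x]reprK -[y]reprK -[c]reprK -!raddfD !torus_mdistE !torus_distE.
by under eq_fun do rewrite opprD addrACA subrr addr0.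
Qed.

Lemma torus_map_lipschitz M :
  exists2 C : R, 0 < C & forall x y, mdist (M .* x) (M .* y) <= C * mdist x y.
Proof.
have [C C0 CP] := @enorm_mulmx R M; exists C => // x y.
rewrite mulrC -ler_pdivrMr// -[x]reprK -[y]reprK.
apply: torus_dist_ge => n; rewrite ler_pdivrMr// mulrC !torus_mapE.
rewrite (le_trans (torus_dist_le _ _ (M *m n)))//.
by rewrite /intv map_mxM/= -!mulmxBr.
Qed.

Lemma torus_map_lipschitz_seq (M : nat -> 'M[int]_2) k :
  exists2 C : R, 0 < C & forall i, (i < k)%N ->
    forall x y, mdist (M i .* x) (M i .* y) <= C * mdist x y.
Proof.
elim: k => [|k [C C0 CP]]; first by exists 1.
have [D D0 DP] := torus_map_lipschitz (M k).
exists (C + D) => [|i]; first by rewrite addr_gt0.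
rewrite ltnS leq_eqVlt => /predU1P[-> x y|ik x y].
  by rewrite (le_trans (DP _ _))// ler_wpM2r ?mdist_ge0// lerDr ltW.
by rewrite (le_trans (CP _ ik _ _))// ler_wpM2r ?mdist_ge0// lerDl ltW.
Qed.

End torus_endomorphisms.

Section torus_quasi_unipotent.
Local Open Scope classical_set_scope.
Context {R : realType}.
Context (A : 'M[int]_2) (k : nat).
Context (k_gt0 : (0 < k)%N) (sqrN : (A ^+ k - 1) ^+ 2 = 0).
Local Notation N := (A ^+ k - 1).
Local Notation "M .* x" := (torus_map (R := R) M x) (at level 40).
Implicit Types (x y z : torus R).

Lemma expr_period q : A ^+ (k * q) = 1 + N *+ q.
Proof. by rewrite exprM -(sqr0_exprD1 _ _ _ sqrN) subrK. Qed.

Lemma drift_expr_period q : N * A ^+ (k * q) = N.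
Proof. by rewrite expr_period mulrDr mulr1 mulrnAr -expr2 sqrN mul0rn addr0. Qed.

(** On a fibre of [N], the iterate at a multiple of [k] is a translation. *)
Lemma mdist_period x y q : N .* x = N .* y ->
  mdist (A ^+ (k * q) .* x) (A ^+ (k * q) .* y) = mdist x y.
Proof.
move=> xy; rewrite expr_period !torus_mapD !torus_map1 !torus_mapMn xy.
exact: mdist_torusDr.
Qed.

(** Iterating further until the time is a multiple of [k] recovers [N .* y], since
the powers of [A] commute with [N] and [drift_expr_period] applies. *)
Lemma drift_expr_inj n y z :
  N .* (A ^+ n .* y) = N .* (A ^+ n .* z) -> N .* y = N .* z.
Proof.
have le_n : (n <= k * n)%N by rewrite leq_pmull.
have push w : A ^+ (k * n - n) .* (N .* (A ^+ n .* w)) = N .* w.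
  rewrite -!torus_mapM.
  have comm : GRing.comm (A ^+ (k * n - n)) N.
    by apply: commrB; [rewrite /GRing.comm -!exprD addnC | exact: commr1].
  by rewrite comm -mulrA -exprD subnK// drift_expr_period.
by move=> yz; rewrite -(push y) -(push z) yz.
Qed.

(** Along the orbit of [x] the value of [N] depends only on the time modulo [k].
Being one of these finitely many values is a closed condition. *)
Lemma drift_orbit_closure (x y : torus_flow R A) : orbit_closure x y ->
  exists i : 'I_k, N .* y = N .* (A ^+ i .* x).
Proof.
pose f (i : 'I_k) : torus R := N .* (A ^+ i .* x).
have Fclosed : closed (range f).
  have [finite_closed _] := @accessible_finite_set_closed (torus R).
  apply: finite_closed; last exact/finite_image/finite_finset.
  exact/hausdorff_accessible/metric_hausdorff.
suff: orbit_closure x `<=` [set y | range f (N .* y)].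
  by move=> + xy => /(_ _ xy)[i _ <-]; exists i.
rewrite /orbit_closure [X in _ `<=` X](closure_id _).1; last first.
  by apply: preimage_closed Fclosed => z _; exact: torus_map_continuous.
apply: closureS => _ [n _ <-] /=.
exists (Ordinal (ltn_pmod n k_gt0)) => //; rewrite /f /= iter_torus_map.
rewrite {2}(divn_eq n k) exprD mulnC torus_mapM -[in RHS]torus_mapM.
by rewrite drift_expr_period.
Qed.

(** Nearby points [y] and [z] of the orbit closure have the same image under [N],
because [N] is Lipschitz and takes finitely many values there. So the iterates at
multiples of [k] keep their distance, and a time [n] is a bounded number of steps
away from the multiples of [k] before and after it: the former bounds the
distance at time [n] by the initial one, the latter the initial one by that at
time [n]. *)
Lemma torus_orbit_bi_equicontinuous (x : torus_flow R A) :
  bi_equicontinuous (orbit_closure x).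
Proof.
pose f (i : 'I_k) : torus R := N .* (A ^+ i .* x).
have [gap gap0 gapP] := finite_image_gap f.
have [D D0 DP] := @torus_map_lipschitz R N.
(* The next multiple of [k] strictly after a time may be [k] steps away. *)
have [C C0 CP] := @torus_map_lipschitz_seq R (fun i => A ^+ i) k.+1.
have drift_eq y z : orbit_closure x y -> orbit_closure x z ->
    mdist y z < gap / D -> N .* y = N .* z.
  move=> /drift_orbit_closure[i yi] /drift_orbit_closure[j zj] yz.
  rewrite yi zj; apply: gapP; rewrite /f -yi -zj.
  by rewrite (le_lt_trans (DP _ _))// mulrC -ltr_pdivlMr.
move=> eps eps0; exists (Num.min (gap / D) (eps / C)).
  by rewrite lt_min !divr_gt0.
move=> y z xy xz n; have xyn := orbit_closure_iter n xy.
have xzn := orbit_closure_iter n xz.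
have before : A ^+ n = A ^+ (n %% k) * A ^+ (k * (n %/ k)).
  by rewrite -exprD addnC mulnC -divn_eq.
have le_nk : (n <= k * (n %/ k).+1)%N by rewrite mulnC ltnW// ltn_ceil.
have after : A ^+ (k * (n %/ k).+1) = A ^+ (k * (n %/ k).+1 - n) * A ^+ n.
  by rewrite -exprD subnK.
have small d : d < eps / C -> C * d < eps by rewrite ltr_pdivlMr// mulrC.
split; rewrite lt_min => /andP[dgap /small deps].
  rewrite !iter_torus_map before !torus_mapM.
  have rk : (n %% k < k.+1)%N by rewrite ltnS ltnW// ltn_pmod.
  apply: le_lt_trans (CP _ rk _ _) _.
  by rewrite (mdist_period _ _ _ (drift_eq _ _ xy xz dgap)).
have := drift_eq _ _ xyn xzn dgap; move: deps.
rewrite !iter_torus_map => deps /drift_expr_inj yz.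
rewrite -(mdist_period _ _ (n %/ k).+1 yz) after !torus_mapM.
apply: le_lt_trans (CP _ _ _ _) deps.
by rewrite ltnS leq_subLR {2}(divn_eq n k) mulnS addnC mulnC addnAC leq_addr.
Qed.

End torus_quasi_unipotent.

Theorem theorem2 (R : realType) (A : 'M[int]_2)
    (detA : \det A = 1 \/ \det A = -1)
    (eigA : forall z : R[i], eigenvalue (map_mx intr A) z -> `|z| = 1) :
  minimally_mean_attractable (torus_flow R A) /\
  minimally_mean_L_stable (torus_flow R A).
Proof.
have [trA trN] := trace_bound _ _ eigA.
have [k k_gt0 sqrN] := quasi_unipotent _ detA trA trN.
apply: bi_equicontinuous_orbits => x.
exact: torus_orbit_bi_equicontinuous k_gt0 sqrN x.
Qed.
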